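(* Let $R$ be an associative ring with unity $1$ and let $a,b,c,v,w,y\in R$ with at least one of $v$, $w$ invertible. Then the following statements are equivalent: (i) $yvawy=y$, $rann(wy)=rann(c)$, and $lann(yv)=lann(b)$. (ii) $yvawb=b$, $cvawy=c$, $rann(c)\subseteq rann(wy)$, and $lann(b)\subseteq lann(yv)$.
   Context: For $x\in R$: $lann(x)=\{z\in R: zx=0\}$ and $rann(x)=\{z\in R: xz=0\}$. *)

(* Defs.v *)
From HB Require Import structures.
From mathcomp Require Import all_boot all_order all_algebra.

Set Implicit Arguments.
Unset Strict Implicit.
Unset Printing Implicit Defensive.

Import GRing.Theory.
Local Open Scope ring_scope.

(* Rings are taken in [pzRingType]: associative and unital, neither           *)
(* commutativity nor 1 != 0 being assumed.                                    *)

Definition lann (R : pzRingType) (x : R) : {pred R} := [pred z | z * x == 0].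

Definition rann (R : pzRingType) (x : R) : {pred R} := [pred z | x * z == 0].

(* Two-sided invertibility; [GRing.unit] would require a [unitRingType],      *)
(* which is nontrivial and comes with a chosen inverse operation.             *)
Definition invertible (R : pzRingType) (x : R) : Prop :=
  exists x' : R, x' * x = 1 /\ x * x' = 1.

(* Main.v *)
Require Import Defs.
From HB Require Import structures.
From mathcomp Require Import all_boot all_order all_algebra.

Import GRing.Theory.
Local Open Scope ring_scope.

(* An equation p * x = x says that p - 1 annihilates x on the left, so the
   inclusions between annihilators carry it from one element x to another:
   y v a w fixes b on the left iff it fixes y v, and v a w y fixes c on the
   right iff it fixes w y. Cancelling an invertible v or w leaves y v a w y = y. *)

Lemma lann_sub1 (R : pzRingType) (x p : R) : (p - 1 \in lann x) = (p * x == x).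
Proof. by rewrite inE mulrBl mul1r subr_eq0. Qed.

Lemma rann_sub1 (R : pzRingType) (x p : R) : (p - 1 \in rann x) = (x * p == x).
Proof. by rewrite inE mulrBr mulr1 subr_eq0. Qed.

Lemma invertible_mulIr (R : pzRingType) (v : R) :
  invertible v -> injective ( *%R^~ v).
Proof. by move=> [v' [_ vv']]; apply: (can_inj (g := *%R^~ v')) => x; rewrite -mulrA vv' mulr1. Qed.

Lemma invertible_mulrI (R : pzRingType) (w : R) :
  invertible w -> injective ( *%R w).
Proof. by move=> [w' [w'w _]]; apply: (can_inj (g := *%R w')) => x; rewrite mulrA w'w mul1r. Qed.

Theorem theorem5p1 (R : pzRingType) (a b c v w y : R)
    (hvw : invertible v \/ invertible w) :
  [/\ y * v * a * w * y = y,
      rann (w * y) =i rann c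
    & lann (y * v) =i lann b]
  <->
  [/\ y * v * a * w * b = b,
      c * v * a * w * y = c,
      {subset rann c <= rann (w * y)}
    & {subset lann b <= lann (y * v)}].
Proof.
split=> [[yE rannE lannE] | [bE cE rann_sub lann_sub]].
  split=> [| |z|z]; rewrite ?rannE ?lannE //; apply/eqP.
    (* Multiplying [yE] by [v] on the right, [y * v * a * w] fixes [y * v], hence also [b]. *)
    by rewrite -lann_sub1 -lannE lann_sub1 mulrA yE.
  rewrite -!mulrA -rann_sub1 -rannE rann_sub1; apply/eqP.
  by rewrite -[in RHS]yE !mulrA.
split.
- case: hvw => [/invertible_mulIr vI | /invertible_mulrI wI].
    (* After cancelling [v], [y * v * a * w] must fix [y * v]; by [bE] it fixes [b]. *)
    apply: vI; apply/eqP; rewrite /= -mulrA -lann_sub1.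
    by apply: lann_sub; rewrite lann_sub1 bE.
  (* Dually, [v * a * w * y] fixes [c], hence [w * y], on the right. *)
  apply: wI; apply/eqP; rewrite -!mulrA [w * _]mulrA -rann_sub1.
  by apply: rann_sub; rewrite rann_sub1 !mulrA cE.
- move=> z; apply/idP/idP; last exact: rann_sub.
  rewrite !inE => /eqP wyz0; apply/eqP.
  (* By [cE], [c * z] is a left multiple of [w * y * z]. *)
  by rewrite -cE -!mulrA [w * _]mulrA wyz0 !mulr0.
- move=> z; apply/idP/idP; last exact: lann_sub.
  rewrite !inE => /eqP zyv0; apply/eqP.
  (* By [bE], [z * b] is a right multiple of [z * (y * v)]. *)
  by rewrite -bE !mulrA -[z * y * v]mulrA zyv0 !mul0r.
Qed.
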